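(* Let $n_1,\ldots,n_t$ be even positive integers and $n=\max\{n_1,\ldots,n_t\}$. Suppose that for each $1\leq i\leq t$ we have $n_i\geq 2\lceil \log (81^t n) \rceil+2$. Then for sufficiently large $n$, $$\hat{R}(C_{n_1},\ldots,C_{n_t})\leq 2\times 81^{2t} (t\ln 81+1)\, n.$$
   Context: $C_k$ denotes the cycle on $k$ vertices. For graphs $G_1,\ldots,G_k$, the size-Ramsey number $\hat{R}(G_1,\ldots,G_k)$ is the smallest integer $m$ for which there exists a graph $H$ with $m$ edges such that for every coloring of the edges of $H$ with colors $1,\ldots,k$ there is, for some $i$, a copy of $G_i$ in $H$ all of whose edges have color $i$. $\log$ denotes the logarithm to base $2$ and $\ln$ the natural logarithm. *)

(* Defs.v *)
From Stdlib Require Import Reals.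
From mathcomp Require Import all_boot.

Set Implicit Arguments.
Unset Strict Implicit.
Unset Printing Implicit Defensive.

Definition simple_graph (N : nat) (adj : rel 'I_N) : Prop :=
  irreflexive adj /\ symmetric adj.

Definition num_edges (N : nat) (adj : rel 'I_N) : nat :=
  #|[set p : 'I_N * 'I_N | (p.1 < p.2)%N && adj p.1 p.2]|.

Definition mono_cycle (N t : nat) (adj : rel 'I_N) (c : 'I_N -> 'I_N -> 'I_t)
    (i : 'I_t) (k : nat) : Prop :=
  (3 <= k)%N /\
  exists f : 'I_k -> 'I_N, injective f /\
    forall j : 'I_k, adj (f j) (f (ordS j)) /\ c (f j) (f (ordS j)) = i.

(* H -> (G_1, ..., G_t) with G_i = C_{ns i}: every t-coloring of the edges of
   H has a color-i copy of C_{ns i} for some i.  Colorings are symmetric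
   functions on pairs of vertices (values on non-edges are irrelevant). *)
Definition arrows_cycles (N t : nat) (adj : rel 'I_N) (ns : 'I_t -> nat) : Prop :=
  forall c : 'I_N -> 'I_N -> 'I_t, (forall x y, c x y = c y x) ->
    exists i : 'I_t, mono_cycle adj c i (ns i).

Definition is_size_ramsey_cycles (t : nat) (ns : 'I_t -> nat) (m : nat) : Prop :=
  (exists (N : nat) (adj : rel 'I_N),
      simple_graph adj /\ num_edges adj = m /\ arrows_cycles adj ns) /\
  (forall (N : nat) (adj : rel 'I_N),
      simple_graph adj -> arrows_cycles adj ns -> (m <= num_edges adj)%N).

Local Open Scope R_scope.
Definition cycle_bound (t n : nat) : R :=
  2 * 81 ^ (2 * t)%nat * (INR t * ln 81 + 1) * INR n.
Local Close Scope R_scope.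

(* Main.v *)
Require Import Defs.
From Stdlib Require Import Reals Lra.
From mathcomp Require Import all_boot zify.

(* Put [n = max ns] and [M = 81 ^ t * n]. A greedy choice of
   [q = floor (cycle_bound t n)] pairs in ['I_M * 'I_M] meets all rectangles with
   sides of size [n], because each rectangle has density [81 ^ (- 2 t)] and there
   are at most [exp (2 n (t ln 81 + 1) - 2)] of them. These pairs are the edges of
   the bipartite host graph.

   Given a colouring, the colours are treated one at a time. Within vertex classes
   of size [81 m], either colour [i] leaves a hole, that is, two subsets of size
   [m] on opposite sides without an edge of colour [i] between them, and the next
   colour is treated inside the hole, or colour [i] contains every even cycle of
   length between [2 (up_log 2 m) + 4] and [m]. If every colour left a hole, the
   last one would be an [n] by [n] rectangle without any edge.

   A graph without holes has a long path by depth-first search, and two further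
   disjoint parts of its vertex set contain expanding subgraphs. A segment of the
   path of prescribed length is attached at its ends to binary trees grown in these
   two subgraphs until they have [m] leaves each; an edge between the two sets of
   leaves closes a cycle. *)

Set Implicit Arguments.
Unset Strict Implicit.
Unset Printing Implicit Defensive.

(** * Bipartite graphs without holes and their expanding cores *)

Section BipartiteCycles.

Variables (T : finType) (e : rel T) (side : pred T).
Hypothesis e_sym : symmetric e.
Hypothesis e_side : forall x y, e x y -> side x = ~~ side y.

Implicit Types (V W S X Y Z : {set T}) (b : bool) (m d : nat).

Definition part V b := [set x in V | side x == b].
Definition nbrs S := [set y | [exists x in S, e x y]].

Definition hole_free m V := forall X Y, X \subset part V true ->
  Y \subset part V false -> m <= #|X| -> m <= #|Y| ->
  exists x y, [/\ x \in X, y \in Y & e x y].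

Lemma nbrsP S y : reflect (exists2 x, x \in S & e x y) (y \in nbrs S).
Proof.
rewrite inE; apply: (iffP existsP) => [[x /andP[]]|[x xS exy]]; first by exists x.
by exists x; rewrite xS.
Qed.

Lemma card_part V : #|part V true| + #|part V false| = #|V|.
Proof.
rewrite -[RHS](cardsID [set x | side x]); congr (_ + _); apply: eq_card => x.
  by rewrite !inE eqb_id.
by rewrite !inE eqbF_neg andbC.
Qed.

Lemma partS V W b : V \subset W -> part V b \subset part W b.
Proof. by move/subsetP=> sVW; apply/subsetP => x; rewrite !inE => /andP[/sVW-> ->]. Qed.

Lemma part_sub V b : part V b \subset V.
Proof. by apply/subsetP => x; rewrite inE => /andP[]. Qed.

Lemma card_partD V W b : W \subset V ->
  #|part (V :\: W) b| + #|part W b| = #|part V b|.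
Proof.
move=> /subsetP sWV; rewrite -[RHS](cardsID W) addnC; congr (_ + _).
  apply: eq_card => x; rewrite !inE; case: (boolP (x \in W)) => [/sWV ->|]; by rewrite ?andbT ?andbF.
by apply: eq_card => x; rewrite !inE andbA.
Qed.

Lemma hole_freeS m V W : W \subset V -> hole_free m V -> hole_free m W.
Proof.
move=> sWV hV X Y sX sY; apply: hV.
  exact: subset_trans sX (partS _ sWV).
exact: subset_trans sY (partS _ sWV).
Qed.

Lemma hole_free_side m V b X Y : hole_free m V -> X \subset part V b ->
  Y \subset part V (~~ b) -> m <= #|X| -> m <= #|Y| ->
  exists x y, [/\ x \in X, y \in Y & e x y].
Proof.
move=> hV; case: b => sX sY mX mY; first exact: hV.
have [x [y [xY yX exy]]] := hV _ _ sY sX mY mX.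
by exists y, x; split=> //; rewrite e_sym.
Qed.

Lemma subset_of_card V k : k <= #|V| -> exists2 W : {set T}, W \subset V & #|W| = k.
Proof.
move=> kV; exists [set x in take k (enum V)].
  by apply/subsetP => x; rewrite inE => /mem_take; rewrite mem_enum.
rewrite cardsE (card_uniqP _) ?take_uniq ?enum_uniq // size_take_min -cardE.
exact/minn_idPl.
Qed.

Lemma carve_parts V k : (forall b, k <= #|part V b|) ->
  exists2 W : {set T}, W \subset V & forall b, #|part W b| = k.
Proof.
move=> kV; have [X sX cX] := subset_of_card (kV true).
have [Y sY cY] := subset_of_card (kV false).
exists (X :|: Y).
  by rewrite subUset (subset_trans sX (part_sub _ _)) (subset_trans sY (part_sub _ _)).
move/subsetP: sX => sX; move/subsetP: sY => sY; case.
  rewrite -cX; apply: eq_card => x; rewrite !inE.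
  apply/andP/idP => [[/orP[//|/sY]]|xX].
    by rewrite inE => /andP[_ /eqP->].
  by rewrite xX; move/sX: xX; rewrite inE => /andP[].
rewrite -cY; apply: eq_card => x; rewrite !inE.
apply/andP/idP => [[/orP[/sX|//]]|xY].
  by rewrite inE => /andP[_ /eqP->].
by rewrite xY orbT; move/sY: xY; rewrite inE => /andP[].
Qed.

Definition expanding m W := forall S, S \subset W -> S != set0 -> #|S| <= 2 * m ->
  4 * #|S| < #|nbrs S :&: W|.

(* [V :\: W] is a maximal set of fewer than [2 * m] vertices that does not
   expand in [V]; adjoining a non-expanding [S] to it would either contradict
   maximality or leave a hole. *)
Lemma expanding_core m V : hole_free m V -> (forall b, 21 * m <= #|part V b|) ->
  0 < m -> exists W, [/\ W \subset V, #|V :\: W| < 2 * m & expanding m W].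
Proof.
move=> hV cV m0.
pose bad Z := [&& Z \subset V, #|Z| < 2 * m & #|(nbrs Z :&: V) :\: Z| <= 4 * #|Z|].
have bad0 : bad set0.
  rewrite /bad sub0set cards0 muln_gt0 m0 /= leqn0 cards_eq0.
  apply/eqP/setP => y; rewrite in_setD in_setI in_set0 /=.
  by apply/negbTE/negP => /andP[/nbrsP[x]]; rewrite inE.
case: (arg_maxnP (fun Z => #|Z|) bad0) => Z /and3P[sZ cZ nZ] maxZ.
exists (V :\: Z); split; first exact: subsetDl.
  by rewrite setDDr setDv set0U (setIidPr sZ).
move=> S sS S0 cS; rewrite ltnNge; apply/negP => nS.
have [sSV dSZ] : S \subset V /\ [disjoint S & Z] by move: sS; rewrite subsetD => /andP[].
have cZS : #|Z :|: S| = #|Z| + #|S|.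
  by rewrite cardsU disjoint_setI0 ?cards0 ?subn0 // disjoint_sym.
have nZS : #|(nbrs (Z :|: S) :&: V) :\: (Z :|: S)| <= 4 * #|Z :|: S|.
  apply: (@leq_trans #|((nbrs Z :&: V) :\: Z) :|: (nbrs S :&: (V :\: Z))|).
    apply/subset_leq_card/subsetP => y.
    rewrite in_setD in_setI in_setU negb_or => /andP[/andP[yZ yS] /andP[/nbrsP[x]]].
    rewrite in_setU => /orP[xZ|xS] exy yV; apply/setUP; [left|right].
      by rewrite !in_setD in_setI yZ yV !andbT; apply/nbrsP; exists x.
    by rewrite in_setI in_setD yZ yV !andbT; apply/nbrsP; exists x.
  by rewrite cZS mulnDr; apply: leq_trans (leq_card_setU _ _) _; apply: leq_add.
have sZS : Z :|: S \subset V by rewrite subUset sZ.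
have S1 : 0 < #|S| by rewrite card_gt0.
(* A union that is still small is itself [bad] and larger than [Z], against maximality. *)
case: (ltnP #|Z :|: S| (2 * m)) => cM.
  have /maxZ : bad (Z :|: S) by rewrite /bad sZS cM.
  rewrite /= cZS; lia.
have [b cb] : exists b, m <= #|part (Z :|: S) b|.
  have := card_part (Z :|: S).
  case: (leqP m #|part (Z :|: S) true|) => [|h1] h2; first by exists true.
  by exists false; lia.
(* [Z :|: S] has fewer than [4 * m] vertices and at most four times as many neighbours outside it.
   Of the [21 * m] vertices on the other side, at least [21 * m - 4 * m - 16 * m = m] thus remain in
   [Y]. *)
pose Y := (part V (~~ b) :\: (Z :|: S)) :\: nbrs (Z :|: S).
have cY : m <= #|Y|.
  have h1 : #|part V (~~ b) :&: (Z :|: S)| <= #|Z :|: S|.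
    exact/subset_leq_card/subsetIr.
  have h2 := cardsID (Z :|: S) (part V (~~ b)).
  have h3 := cardsID (nbrs (Z :|: S)) (part V (~~ b) :\: (Z :|: S)).
  have h4 : #|(part V (~~ b) :\: (Z :|: S)) :&: nbrs (Z :|: S)| <= 4 * #|Z :|: S|.
    apply: leq_trans nZS; apply/subset_leq_card/subsetP => y.
    rewrite in_setI in_setD => /andP[/andP[yZS yV] ny].
    by rewrite in_setD in_setI yZS ny (subsetP (part_sub _ _) _ yV).
  have h5 := cV (~~ b); rewrite /Y; lia.
have [x [y [xX yY exy]]] := hole_free_side hV (partS b sZS)
  (subset_trans (subsetDl _ _) (subsetDl _ _)) cb cY.
move: yY; rewrite in_setD => /andP[/negP[]]; apply/nbrsP; exists x => //.
exact: (subsetP (part_sub _ _) _ xX).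
Qed.

(** * Trees, depth-first search and long paths *)

Definition walk_in W w p := [/\ path e w p, uniq (w :: p) & {subset w :: p <= W}].

Lemma binary_tree m W w d : expanding m W -> w \in W ->
  (forall j, j < d -> 2 ^ j <= 2 * m) ->
  exists L : {set T}, [/\ L \subset W, #|L| = 2 ^ d &
    forall x, x \in L -> exists p, [/\ walk_in W w p, size p = d & last w p = x]].
Proof.
move=> expW wW.
(* The induction carries the vertex set [U] of the whole tree: new leaves are taken outside [U],
   which keeps the walks free of repetitions. *)
suff tree : (forall j, j < d -> 2 ^ j <= 2 * m) -> exists U L : {set T},
    [/\ U \subset W, L \subset U, #|L| = 2 ^ d /\ #|U| < 2 ^ d.+1 &
    forall x, x \in L -> exists p, [/\ walk_in U w p, size p = d & last w p = x]].
  move/tree=> [U [L [sU sL [cL _] hL]]]; exists L; split=> //.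
    exact: subset_trans sU.
  move=> x /hL[p [[? ? sp] ? ?]]; exists p; split=> //; split=> //.
  by move=> z /sp; apply: (subsetP sU).
elim: d => [_|d IH hd].
  exists [set w], [set w]; split; rewrite ?sub1set ?set11 ?cards1 //.
  move=> x /set1P->; exists [::]; split=> //; split=> // z.
  by rewrite inE => /eqP->; rewrite inE.
have [U [L [sU sL [cL cU] hL]]] := IH (fun j jd => hd j (ltnW jd)).
have L0 : L != set0 by rewrite -card_gt0 cL expn_gt0.
have expL : 4 * #|L| < #|nbrs L :&: W|.
  by apply: expW; rewrite ?(subset_trans sL) // cL; apply: hd.
have [L' sL' cL'] : exists2 L' : {set T}, L' \subset (nbrs L :&: W) :\: U & #|L'| = 2 ^ d.+1.
  apply: subset_of_card; have := cardsID U (nbrs L :&: W).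
  have : #|(nbrs L :&: W) :&: U| <= #|U| by exact/subset_leq_card/subsetIr.
  by move: expL cU; rewrite cL !expnS; lia.
exists (U :|: L'), L'; split.
- rewrite subUset sU (subset_trans sL') //.
  by apply: subset_trans (subsetDl _ _) (subsetIr _ _).
- exact: subsetUr.
- split=> //; have [+ _] := leq_card_setU U L'; rewrite cL'; move: cU; rewrite !expnS; lia.
move=> x xL'; have /setDP[/setIP[/nbrsP[y yL eyx] _] xU] := subsetP sL' _ xL'.
have [p [[pp up sp] szp lp]] := hL y yL.
exists (rcons p x); split; rewrite ?size_rcons ?szp ?last_rcons //; split.
- by rewrite rcons_path pp lp.
- rewrite -rcons_cons rcons_uniq up andbT; apply: contra xU; exact: sp.
move=> z; rewrite -rcons_cons mem_rcons inE => /orP[/eqP->|/sp zU].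
  by rewrite inE xL' orbT.
by rewrite inE zU.
Qed.

Lemma side_last w p : path e w p -> side (last w p) = side w (+) odd (size p).
Proof.
elim: p w => [|x p IH] w /=; first by rewrite addbF.
by case/andP=> /e_side-> /IH->; case: (side x); case: odd.
Qed.

(* The state of a depth-first search at the moment when exactly [k] vertices
   have been backtracked: [D] is the set of these, [p] is the current path
   and no edge joins [D] to the unexplored vertices. *)
Lemma depth_first_search V k : k <= #|V| -> exists (D : {set T}) p,
  [/\ D \subset V, #|D| = k, uniq p /\ sorted e p, {subset p <= V :\: D} &
      forall x y, x \in D -> y \in V -> y \notin D -> y \notin p -> ~~ e x y].
Proof.
elim: k => [_|k IH kV].
  exists set0, [::]; split; rewrite ?sub0set ?cards0 //.
  by move=> x y; rewrite inE.
have [D [p0 hp0]] := IH (ltnW kV).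
pose good p := [/\ uniq p /\ sorted e p, {subset p <= V :\: D} &
      forall x y, x \in D -> y \in V -> y \notin D -> y \notin p -> ~~ e x y].
have [sD cD gp0] : [/\ D \subset V, #|D| = k & good p0] by case: hp0.
(* With [D] fixed, take a longest admissible path. Its last vertex has no unexplored neighbour,
   since appending one would lengthen the path, so it can be backtracked into [D]. *)
have [p [gp maxp]] : exists p, good p /\ forall q, good q -> size q <= size p.
  have bnd q : good q -> size q <= #|V|.
    case=> -[uq _] sq _; rewrite -(card_uniqP uq).
    apply/subset_leq_card/subsetP => x /sq; by rewrite inE => /andP[].
  have [r] := ubnP (#|V| - size p0).
  elim: r {hp0} p0 gp0 => [|r IHr] p gp hr //.
  case: (Classical_Prop.classic (exists q, good q /\ size p < size q)) => [[q [gq pq]]|no].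
    by apply: (IHr q gq); have := bnd _ gq; lia.
  exists p; split=> // q gq; rewrite leqNgt; apply/negP => pq; by case: no; exists q.
have [[up ep] sp nDp] := gp.
case: (lastP p) => [|p' x] in gp maxp up ep sp nDp *.
  (* An empty path is not longest: as [k < #|V|], some vertex outside [D] can start a new one. *)
  have [z zV zD] : exists2 z, z \in V & z \notin D.
    have : 0 < #|V :\: D| by have := cardsID D V; rewrite (setIidPr sD); lia.
    by case/card_gt0P => z /setDP[]; exists z.
  have /maxp // : good [:: z].
  split=> //.
    by move=> t; rewrite inE => /eqP->; rewrite inE zV zD.
  by move=> a b aD bV bD _; apply: nDp.
have /setDP[xV xD] : x \in V :\: D by apply: sp; rewrite mem_rcons inE eqxx.
exists (x |: D), p'; split.
- by rewrite subUset sub1set xV.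
- by rewrite cardsU1 xD cD.
- move: up ep; rewrite rcons_uniq => /andP[_ ->].
  case: p' {gp maxp sp nDp} => //= a s; by rewrite rcons_path => /andP[].
- move=> z zp; have /setDP[zV zD] : z \in V :\: D by apply: sp; rewrite mem_rcons inE zp orbT.
  rewrite !inE negb_or zV zD !andbT; apply/eqP => zx.
  by move: up; rewrite rcons_uniq -zx zp.
move=> a y; rewrite !inE negb_or => aD yV /andP[yx yD] yp.
have yp' : y \notin rcons p' x by rewrite mem_rcons inE negb_or yx.
case/orP: aD => [/eqP->|aD]; last exact: nDp.
apply/negP => exy.
have /maxp : good (rcons (rcons p' x) y).
  split.
  - rewrite rcons_uniq yp' up; split=> //.
    by case: p' ep {gp maxp up sp nDp yp yp'} => /= [|c s]; rewrite ?andbT // !rcons_path ?last_rcons exy => ->.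
  - move=> z; rewrite mem_rcons inE => /orP[/eqP->|]; last exact: sp.
    by rewrite inE yV yD.
  move=> c z Dc zV zD; rewrite mem_rcons inE negb_or => /andP[_]; exact: nDp.
by rewrite size_rcons ltnn.
Qed.

(** Stop the search after [2 * m] backtrackings, so that [D] has [m] vertices on some side. If the
    path had fewer than [k] vertices, at least [k + 3 * m - 2 * m - k = m] vertices of the opposite
    side would be unexplored, and [D] would form a hole with them. *)
Lemma long_path m V k : hole_free m V -> (forall b, k + 3 * m <= #|part V b|) ->
  exists p, [/\ uniq p, sorted e p, {subset p <= V} & k <= size p].
Proof.
move=> hV cV.
have [|D [p [sD cD [up ep] sp nDp]]] := @depth_first_search V (2 * m).
  have := card_part V; have := cV true; have := cV false; lia.
exists p; split=> //; first by move=> x /sp /setDP[].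
have [b cb] : exists b, m <= #|part D b|.
  have := card_part D.
  case: (leqP m #|part D true|) => [|h1] h2; first by exists true.
  by exists false; lia.
rewrite leqNgt; apply/negP => kp.
pose Y := (part V (~~ b) :\: D) :\: [set x in p].
have cY : m <= #|Y|.
  have h1 : #|part V (~~ b) :&: D| <= #|D| by exact/subset_leq_card/subsetIr.
  have h2 := cardsID D (part V (~~ b)).
  have h3 := cardsID [set x in p] (part V (~~ b) :\: D).
  have h4 : #|(part V (~~ b) :\: D) :&: [set x in p]| <= size p.
    rewrite -(card_uniqP up) -[X in _ <= X]cardsE; exact/subset_leq_card/subsetIr.
  have h5 := cV (~~ b); rewrite /Y; lia.
have [x [y [xX]]] := hole_free_side hV (partS b sD)
  (subset_trans (subsetDl _ _) (subsetDl _ _)) cb cY.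
rewrite !in_setD inE => /and3P[yp yD yV]; apply/negP.
apply: nDp => //; [exact: (subsetP (part_sub _ _) _ xX) | exact: (subsetP (part_sub _ _) _ yV)].
Qed.

(** * Closing a path segment into a cycle *)

(** Among [2 * m] vertices without neighbours in [W], some [m] lie on one side; with the opposite
    part of [W] they would form a hole. *)
Lemma card_isolated m V V1 W : hole_free m V -> V1 \subset V -> W \subset V ->
  0 < m -> (forall b, m <= #|part W b|) -> #|V1 :\: nbrs W| < 2 * m.
Proof.
move=> hV sV1 sW m0 cW; rewrite ltnNge; apply/negP => cX.
have [b cb] : exists b, m <= #|part (V1 :\: nbrs W) b|.
  have := card_part (V1 :\: nbrs W).
  case: (leqP m #|part (V1 :\: nbrs W) true|) => [|h1] h2; first by exists true.
  by exists false; lia.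
have [x [y [xX yY exy]]] := hole_free_side hV
  (partS b (subset_trans (subsetDl _ _) sV1)) (partS _ sW) cb (cW (~~ b)).
have /setDP[_ /negP[]] := subsetP (part_sub _ _) _ xX.
by apply/nbrsP; exists y; rewrite ?(subsetP (part_sub _ _) _ yY) // e_sym.
Qed.

Lemma card_core m V W k b : W \subset V -> #|V :\: W| < 2 * m ->
  k + 2 * m <= #|part V b| -> k <= #|part W b|.
Proof.
move=> sW cZ cV; have := card_partD b sW.
have := subset_leq_card (part_sub (V :\: W) b); lia.
Qed.

Lemma uniq_cat_disjoint (s1 s2 : seq T) X Y : {subset s1 <= X} -> {subset s2 <= Y} ->
  [disjoint X & Y] -> uniq s1 -> uniq s2 -> uniq (s1 ++ s2).
Proof.
move=> s1X s2Y dXY u1 u2; rewrite cat_uniq u1 u2 andbT /=; apply/hasPn => x /s2Y xY.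
by apply/negP => /s1X xX; move/pred0P: dXY => /(_ x) /=; rewrite xX xY.
Qed.

(* [V] is split into [V2] and [V3], with [21 * m] vertices on each side as
   [expanding_core] requires, and [V1], with [39 * m] on each side, which contains
   a path on [36 * m] vertices. At most [4 * m] positions of that path are useless
   as starting points of a segment with [l] edges whose ends see the cores of
   [V2] and [V3]. Such a segment is closed up through two binary trees of depth
   [d], whence [k = l + (2 * d + 3)]; as [l] is odd, the two sets of leaves lie
   on opposite sides. *)
Lemma hole_free_cycle m V k : hole_free m V -> 0 < m ->
  (forall b, 81 * m <= #|part V b|) -> ~~ odd k -> 2 * up_log 2 m + 4 <= k ->
  k <= m -> exists s, [/\ uniq s, size s = k & cycle e s].
Proof.
move=> hV m0 cV ek dk km.
have [|V2 sV2 cV2] := @carve_parts V (21 * m).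
  by move=> b; have := cV b; lia.
have [|V3 sV3 cV3] := @carve_parts (V :\: V2) (21 * m).
  by move=> b; have := card_partD b sV2; have := cV b; have := cV2 b; lia.
pose V1 := (V :\: V2) :\: V3.
have sV3V : V3 \subset V := subset_trans sV3 (subsetDl _ _).
have sV1V : V1 \subset V := subset_trans (subsetDl _ _) (subsetDl _ _).
have dV32 : [disjoint V3 & V2] by move: sV3; rewrite subsetD => /andP[].
have cV1 b : 36 * m + 3 * m <= #|part V1 b|.
  have := card_partD b sV2; have := card_partD b sV3.
  have := cV b; have := cV2 b; have := cV3 b; rewrite /V1; lia.
have [W2 [sW2 cW2 xW2]] := expanding_core (hole_freeS sV2 hV)
  (fun b => eq_leq (esym (cV2 b))) m0.
have [W3 [sW3 cW3 xW3]] := expanding_core (hole_freeS sV3V hV)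
  (fun b => eq_leq (esym (cV3 b))) m0.
have [p [up ep sp szp]] := long_path (hole_freeS sV1V hV) cV1.
have iso2 : #|V1 :\: nbrs W2| < 2 * m.
  apply: card_isolated hV sV1V (subset_trans sW2 sV2) m0 _ => b.
  by apply: (card_core sW2 cW2); rewrite cV2 -mulSn leq_mul2r orbT.
have iso3 : #|V1 :\: nbrs W3| < 2 * m.
  apply: card_isolated hV sV1V (subset_trans sW3 sV3V) m0 _ => b.
  by apply: (card_core sW3 cW3); rewrite cV3 -mulSn leq_mul2r orbT.
pose d := up_log 2 m; have md : m <= 2 ^ d by exact: up_logP.
have powd j : j < d -> 2 ^ j <= 2 * m.
  move=> jd; apply: leq_trans (leq_pmull _ _) => //; apply: ltnW.
  by rewrite ltnNge; apply/negP => /(up_log_min (isT : 1 < 2)); rewrite leqNgt jd.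
(* The segment contributes [l + 1] vertices to the cycle and each tree branch [d + 1]. *)
have [l lk] : exists l, k = l + (2 * d + 3).
  by exists (k - (2 * d + 3)); rewrite subnK //; move: dk; rewrite -/d; clear; lia.
clearbody d.
have ol : odd l by move: ek; rewrite lk; clear; lia.
have [x0 _] : exists x, x \in p.
  case: p szp {up ep sp} => [|x s _]; last by exists x; rewrite inE eqxx.
  by rewrite leqNgt muln_gt0 m0.
have [i il [i2 i3]] : exists2 i, i + l < size p &
    nth x0 p i \in nbrs W2 /\ nth x0 p (i + l) \in nbrs W3.
  (* [I] counts the positions from which [l] further steps stay on the path; there are at least
     [35 * m] of them, because [l <= k <= m]. *)
  pose I := size p - l.
  pose bad2 := [set j : 'I_I | nth x0 p j \notin nbrs W2].
  pose bad3 := [set j : 'I_I | nth x0 p (j + l) \notin nbrs W3].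
  have ltI (j : 'I_I) : j + l < size p by rewrite addnC -ltn_subRL.
  have ltI' (j : 'I_I) : j < size p := leq_ltn_trans (leq_addr _ _) (ltI j).
  have c2 : #|bad2| < 2 * m.
    apply: leq_ltn_trans iso2.
    rewrite -(@card_in_imset _ _ (fun j : 'I_I => nth x0 p j)) => [|j1 j2 _ _ /eqP].
      apply/subset_leq_card/subsetP => _ /imsetP[j jb ->].
      by rewrite inE in jb; rewrite inE jb; apply/sp/mem_nth.
    rewrite nth_uniq ?up //.
    by move/eqP/val_inj.
  have c3 : #|bad3| < 2 * m.
    apply: leq_ltn_trans iso3.
    rewrite -(@card_in_imset _ _ (fun j : 'I_I => nth x0 p (j + l))) => [|j1 j2 _ _ /eqP].
      apply/subset_leq_card/subsetP => _ /imsetP[j jb ->].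
      by rewrite inE in jb; rewrite inE jb; apply/sp/mem_nth.
    rewrite nth_uniq ?up //.
    by rewrite eqn_add2r => /eqP/val_inj.
  have : 0 < #|~: (bad2 :|: bad3)|.
    have := cardsC (bad2 :|: bad3); have [+ _] := leq_card_setU bad2 bad3.
    have : 35 * m <= I by rewrite /I; move: szp km lk; clear; lia.
    rewrite card_ord; move: c2 c3 m0; clearbody bad2 bad3 I; clear.
    by move: #|_| #|_| #|_| #|_|; lia.
  case/card_gt0P => j; rewrite in_setC in_setU negb_or => /andP[j2 j3].
  exists j; first exact: ltI.
  by move: j2 j3; rewrite in_set negbK => j2; rewrite in_set negbK.
pose u := nth x0 p i; pose v := nth x0 p (i + l).
have [q [pq lq sq uq qV]] : exists q, [/\ path e u q, last u q = v, size q = l,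
    uniq (u :: q) & {subset u :: q <= V1}].
  exists (take l (drop i.+1 p)).
  have E : u :: take l (drop i.+1 p) = take l.+1 (drop i p).
    by rewrite [in RHS](drop_nth x0) //; exact: leq_ltn_trans (leq_addr l i) il.
  have sz : size (take l (drop i.+1 p)) = l.
    by rewrite size_takel // size_drop; move: il; clear; lia.
  split=> //.
  - have : sorted e (take l.+1 (drop i p)) by apply/take_sorted/drop_sorted.
    by rewrite -E.
  - by rewrite (last_nth x0) E sz nth_take // nth_drop.
  - by rewrite E take_uniq ?drop_uniq.
  by rewrite E => z /mem_take/mem_drop/sp.
have /nbrsP[u' u'W eu'] := i2; have /nbrsP[v' v'W ev'] := i3.
have [L2 [sL2 cL2 hL2]] := binary_tree xW2 u'W powd.
have [L3 [sL3 cL3 hL3]] := binary_tree xW3 v'W powd.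
have sdv : side v = ~~ side u by rewrite -lq (side_last pq) sq ol addbT.
have sL2p : L2 \subset part V (side u' (+) odd d).
  apply/subsetP => x xL; rewrite inE (subsetP sV2) ?(subsetP sW2) ?(subsetP sL2) //=.
  by have [r [[pr _ _] <- <-]] := hL2 _ xL; rewrite (side_last pr).
have sL3p : L3 \subset part V (~~ (side u' (+) odd d)).
  apply/subsetP => x xL; rewrite inE (subsetP sV3V) ?(subsetP sW3) ?(subsetP sL3) //=.
  have [r [[pr _ _] <- <-]] := hL3 _ xL; rewrite (side_last pr) (e_side eu') (e_side ev').
  by rewrite -/u -/v sdv; case: (side u); case: odd.
have [x [y [xL yL exy]]] : exists x y, [/\ x \in L2, y \in L3 & e x y].
  by apply: hole_free_side hV sL2p sL3p _ _; rewrite ?cL2 ?cL3.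
have [r2 [[pr2 ur2 sr2] zr2 lr2]] := hL2 x xL.
have [r3 [[pr3 ur3 sr3] zr3 lr3]] := hL3 y yL.
(* The cycle follows the path from [u] to [v], crosses to [v'], descends the second tree to [y],
   jumps to [x] and climbs the first tree to [u'], a neighbour of [u]. *)
exists ((u :: q) ++ (v' :: r3) ++ rev (u' :: r2)); split.
- apply: (uniq_cat_disjoint qV (Y := V2 :|: V3)).
  + move=> z; rewrite mem_cat mem_rev in_setU => /orP[/sr3/(subsetP sW3)->|/sr2/(subsetP sW2)->] //.
    by rewrite orbT.
  + rewrite -setI_eq0; apply/eqP/setP => z; rewrite /V1 !inE.
    by case: (z \in V2); case: (z \in V3); rewrite ?andbF.
  + by [].
  apply: (uniq_cat_disjoint (X := V3) (Y := V2)) => //.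
  + by move=> z /sr3/(subsetP sW3).
  + by move=> z; rewrite mem_rev => /sr2/(subsetP sW2).
  by rewrite rev_uniq.
- rewrite !size_cat size_rev /= sq zr2 zr3 lk; clear; lia.
rewrite (lastI u' r2) rev_rcons lr2 /= rcons_path cat_path pq lq /=.
rewrite e_sym ev' /= cat_path pr3 lr3 /= e_sym exy /=.
have -> : path e x (rev (belast u' r2)).
  by rewrite -lr2 rev_path (eq_path (e' := e)) // => a b; rewrite e_sym.
rewrite last_cat /= last_cat /=.
suff -> : last x (rev (belast u' r2)) = u' by [].
by rewrite -lr2; case: r2 {pr2 ur2 sr2 zr2 lr2} => //= a s; rewrite rev_cons last_rcons.
Qed.

End BipartiteCycles.

(** * A small set of pairs meeting all rectangles *)

(** Always add the point missed by the fewest surviving sets: on average a point is missed by at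
    most a fraction [1 - r / #|P|] of them. Clearing denominators keeps the estimate in [nat]. *)
Lemma greedy_hitting_set (P : finType) (F : {set {set P}}) r q :
  (forall A, A \in F -> r <= #|A|) ->
  exists E : {set P}, #|E| <= q /\
    #|[set A in F | [disjoint A & E]]| * #|P| ^ q <= #|F| * (#|P| - r) ^ q.
Proof.
move=> cF; elim: q => [|q [E [cE hE]]].
  exists set0; rewrite cards0 !muln1; split=> //.
  by apply/subset_leq_card/subsetP => A; rewrite inE => /andP[].
set G := [set A in F | _] in hE.
case: (posnP #|P|) => [P0|/card_gt0P[p0 _]].
  by exists set0; rewrite cards0 P0 exp0n // muln0.
pose miss p := #|[set A in G | p \notin A]|.
have [p _ minp] := arg_minnP miss (isT : xpredT p0).
have avg : miss p * #|P| <= #|G| * (#|P| - r).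
  apply: (@leq_trans (\sum_(x : P) miss x)).
    by rewrite mulnC -sum_nat_const; apply: leq_sum => x _; apply: minp.
  (* Double counting of the pairs of a point and a surviving set that misses it. *)
  rewrite /miss; under eq_bigr => x _ do rewrite -sum1dep_card big_mkcondr.
  rewrite exchange_big -sum_nat_const; apply: leq_sum => A.
  rewrite inE => /andP[/cF rA _]; rewrite -big_mkcond sum1dep_card.
  rewrite (_ : [set x | x \notin A] = ~: A); last by apply/setP => x; rewrite !inE.
  by rewrite cardsCs setCK leq_sub2l.
exists (p |: E); split.
  by rewrite cardsU1; case: (p \notin E); rewrite ?ltnS // add0n ltnW.
apply: (@leq_trans (miss p * #|P| ^ q.+1)).
  rewrite leq_mul2r; apply/orP; right; apply/subset_leq_card/subsetP => A.
  rewrite !inE => /andP[-> dA]; rewrite (disjointWr (subsetUr _ _) dA) /=.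
  by apply/negP => pA; have := disjointFr dA pA; rewrite setU11.
rewrite !expnS mulnA; apply: (@leq_trans (#|G| * (#|P| - r) * #|P| ^ q)).
  by rewrite leq_mul2r avg orbT.
by rewrite mulnAC [X in _ <= X]mulnCA mulnC leq_mul2l hE orbT.
Qed.

(** If one rectangle were missed, the count of missed ones would be at least 1, against [small]. *)
Lemma rectangle_hitting_set M n q :
  'C(M, n) ^ 2 * (M ^ 2 - n ^ 2) ^ q < (M ^ 2) ^ q ->
  exists E : {set 'I_M * 'I_M}, #|E| <= q /\ forall X Y : {set 'I_M},
    #|X| = n -> #|Y| = n -> exists a b, [/\ a \in X, b \in Y & (a, b) \in E].
Proof.
move=> small.
pose D := [set X : {set 'I_M} | #|X| == n].
pose F := [set setX X.1 X.2 | X in setX D D].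
have cF A : A \in F -> n ^ 2 <= #|A|.
  case/imsetP => -[X Y]; rewrite !inE /= => /andP[/eqP cX /eqP cY] ->.
  by rewrite cardsX cX cY mulnn.
have [E [cE hE]] := greedy_hitting_set q cF.
exists E; split=> // X Y cX cY.
have FXY : setX X Y \in F by apply/imsetP; exists (X, Y); rewrite ?inE //= cX cY eqxx.
have cFle : #|F| <= 'C(M, n) ^ 2.
  by apply: leq_trans (leq_imset_card _ _) _; rewrite cardsX card_draws card_ord mulnn.
have : ~~ [disjoint setX X Y & E].
  apply/negP => dE; move: small; rewrite ltnNge; case/negP.
  rewrite card_prod card_ord mulnn in hE.
  apply: leq_trans (_ : #|F| * (M ^ 2 - n ^ 2) ^ q <= _); last first.
    by rewrite leq_mul2r cFle orbT.
  apply: leq_trans hE; rewrite leq_pmull // card_gt0.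
  by apply/set0Pn; exists (setX X Y); rewrite inE FXY.
case/pred0Pn => -[a b] /=; rewrite !inE => /andP[/andP[aX bY] abE].
by exists a, b.
Qed.

(** * Real estimates for the number of pairs *)

Section Numerics.
Local Open Scope R_scope.

Lemma INR_expn a k : INR (expn a k) = INR a ^ k.
Proof. by elim: k => [|k IH] //; rewrite expnS mult_INR IH. Qed.

Lemma exp_pow x k : exp x ^ k = exp (INR k * x).
Proof.
elim: k => [|k IH]; first by rewrite /= Rmult_0_l exp_0.
by rewrite S_INR -tech_pow_Rmult IH -exp_plus; congr exp; ring.
Qed.

(** A weak Stirling bound, by induction from [(1 + 1 / j) ^ j <= exp 1]. *)
Lemma fact_lower k : (0 < k)%N -> INR k ^ k * exp (1 - INR k) <= INR (k`!).
Proof.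
elim: k => // -[_ _|k IH _].
  by rewrite /= (_ : 1 - 1 = 0) ?exp_0; lra.
have {}IH := IH isT; set j := k.+1 in IH *.
have j0 : 0 < INR j by apply: lt_0_INR; lia.
have stepj : INR j.+1 ^ j <= INR j ^ j * exp 1.
  have -> : INR j.+1 = INR j * (1 + / INR j) by rewrite S_INR; field; lra.
  rewrite Rpow_mult_distr; apply: Rmult_le_compat_l; first by apply: pow_le; lra.
  have i0 := Rinv_0_lt_compat _ j0.
  apply: (Rle_trans _ (exp (/ INR j) ^ j)).
    by apply: pow_incr; split; [lra | apply: exp_ineq1_le].
  by rewrite exp_pow Rinv_r; [apply: Rle_refl | lra].
rewrite factS mult_INR -tech_pow_Rmult Rmult_assoc.
apply: Rmult_le_compat_l; first exact: pos_INR.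
apply: Rle_trans IH; rewrite (_ : 1 - INR j = 1 + (1 - INR j.+1)); last first.
  by rewrite S_INR; ring.
rewrite exp_plus -Rmult_assoc; apply: Rmult_le_compat_r => //.
exact/Rlt_le/exp_pos.
Qed.

(** Bound the binomial by [M ^ n / n!] and apply [fact_lower]. The [- 1] in the exponent is the
    slack that later pays for rounding [cycle_bound] down. *)
Lemma bin_upper t n : (0 < n)%N ->
  INR 'C(81 ^ t * n, n) <= exp (INR n * (INR t * ln 81 + 1) - 1).
Proof.
move=> n0; set M := (81 ^ t * n)%N.
have n0R : 0 < INR n by apply: lt_0_INR; lia.
have ffact_le k : (M ^_ k <= M ^ k)%N.
  elim: k => // k IH.
  by rewrite ffactnSr expnSr leq_mul // leq_subr.
have h : INR 'C(M, n) * INR n`! <= INR M ^ n.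
  by rewrite -mult_INR multE bin_ffact -INR_expn; apply: le_INR; apply/leP.
have K : INR (81 ^ t) = exp (INR t * ln 81).
  rewrite -exp_pow exp_ln; last lra.
  by rewrite INR_expn; congr pow; rewrite /=; ring.
have g := fact_lower n0.
have p0 : 0 < INR n ^ n * exp (1 - INR n).
  by apply: Rmult_lt_0_compat; [apply: pow_lt | apply: exp_pos].
apply: (Rmult_le_reg_r _ _ _ p0).
apply: Rle_trans (Rmult_le_compat_l _ _ _ (pos_INR _) g) _.
apply: Rle_trans h _; rewrite /M mult_INR K Rpow_mult_distr exp_pow.
rewrite (_ : exp (INR n * (INR t * ln 81 + 1) - 1) * (INR n ^ n * exp (1 - INR n)) =
  exp (INR n * (INR t * ln 81 + 1) - 1) * exp (1 - INR n) * INR n ^ n); last by ring.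
rewrite -exp_plus; apply: Req_le; congr (exp _ * _); ring.
Qed.

Lemma rectangle_count t n q : (0 < n)%N -> cycle_bound t n - 1 < INR q ->
  ('C(81 ^ t * n, n) ^ 2 * ((81 ^ t * n) ^ 2 - n ^ 2) ^ q < ((81 ^ t * n) ^ 2) ^ q)%N.
Proof.
move=> n0 hq; apply/ltP/INR_lt.
set K := INR (81 ^ t).
have n0R : 0 < INR n by apply: lt_0_INR; lia.
have K1 : 1 <= K by rewrite /K -[1]/(INR 1); apply: le_INR; apply/leP; rewrite expn_gt0.
have KK : 1 <= K ^ 2 by rewrite -(pow1 2); apply: pow_incr; lra.
have c0 := bin_upper t n0; set c := INR _ in c0.
rewrite mult_INR !INR_expn minus_INR; last first.
  by apply/leP; rewrite leq_exp2r // leq_pmull // expn_gt0.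
rewrite !INR_expn mult_INR -/c -/K.
have -> : (K * INR n) ^ 2 - INR n ^ 2 = (1 - / K ^ 2) * (K * INR n) ^ 2 by field; lra.
rewrite Rpow_mult_distr -Rmult_assoc -[X in _ < X]Rmult_1_l.
apply: Rmult_lt_compat_r.
  by do 2 apply: pow_lt; apply: Rmult_lt_0_compat; lra.
have iK : / K ^ 2 <= 1 by rewrite -Rinv_1; apply: Rinv_le_contravar; lra.
have iK0 : 0 < / K ^ 2 by apply: Rinv_0_lt_compat; lra.
apply: (Rle_lt_trans _ (exp (INR n * (INR t * ln 81 + 1) - 1) ^ 2 * exp (- / K ^ 2) ^ q)).
  apply: Rmult_le_compat.
  - by apply: pow_le; apply: pos_INR.
  - by apply: pow_le; lra.
  - by apply: pow_incr; split=> //; apply: pos_INR.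
  by apply: pow_incr; split; [lra | apply: exp_ineq1_le].
rewrite !exp_pow -exp_plus -[X in _ < X]exp_0; apply: exp_increasing.
(* Rounding costs less than [/ K ^ 2 <= 1] in the exponent, and the two binomials together leave a
   slack of 2. *)
have hq' : cycle_bound t n * / K ^ 2 - 1 < INR q * / K ^ 2.
  have := Rmult_lt_compat_r _ _ _ iK0 hq; lra.
suff E : cycle_bound t n * / K ^ 2 = 2 * (INR n * (INR t * ln 81 + 1)).
  rewrite E in hq'; rewrite (_ : INR 2 = 2) //; lra.
rewrite /cycle_bound (_ : 81 ^ (2 * t) = K ^ 2); first by field; lra.
rewrite mulnC pow_mult /K INR_expn; congr ((_ ^ _) ^ _); by rewrite /=; ring.
Qed.

Lemma cycle_bound_ge0 t n : 0 <= cycle_bound t n.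
Proof.
have ln0 : 0 < ln 81 by rewrite -ln_1; apply: ln_increasing; lra.
have tln : 0 <= INR t * ln 81 by apply: Rmult_le_pos; [apply: pos_INR | lra].
apply: Rmult_le_pos (pos_INR n); apply: Rmult_le_pos; last lra.
by apply: Rmult_le_pos; [lra | apply: pow_le; lra].
Qed.

Lemma nat_floor r : 0 <= r -> exists q, INR q <= r /\ r - 1 < INR q.
Proof.
move=> r0; have [a b] := archimed r.
have u0 : (0 < up r)%Z by apply: lt_IZR; lra.
have [|q Eq] := IZN (up r - 1); first lia.
by exists q; rewrite INR_IZR_INZ -Eq minus_IZR; lra.
Qed.

End Numerics.

(** * The bipartite host graph *)

Section HostGraph.

Variables (M : nat) (E : {set 'I_M * 'I_M}).

Definition host_adj : rel 'I_(M + M) := fun x y =>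
  match split x, split y with
  | inl a, inr b | inr b, inl a => (a, b) \in E
  | _, _ => false
  end.

Definition host_side (x : 'I_(M + M)) : bool :=
  if split x is inl _ then true else false.

Lemma host_simple : simple_graph host_adj.
Proof.
split=> [x|x y]; rewrite /host_adj; first by case: split.
by case: (split x); case: (split y).
Qed.

Lemma host_adj_side x y : host_adj x y -> host_side x = ~~ host_side y.
Proof. by rewrite /host_adj /host_side; case: (split x); case: (split y). Qed.

Lemma num_edges_host : num_edges host_adj <= #|E|.
Proof.
pose g (ab : 'I_M * 'I_M) := (lshift M ab.1, rshift M ab.2).
apply: leq_trans (leq_imset_card g _).
apply/subset_leq_card/subsetP => -[x y]; rewrite inE /= /host_adj.
case: split_ordP => a ->; case: split_ordP => b -> /andP[lt abE] //.
  by apply/imsetP; exists (a, b).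
(* Left vertices precede right ones, so an edge listed in increasing order cannot start on the
   right; each pair of [E] is counted only once. *)
by move: lt; rewrite /=; have := ltn_ord b; lia.
Qed.

End HostGraph.

(** Links [cycle] on sequences to the cyclic successor used in [mono_cycle]. *)
Lemma cycle_ordS (T : Type) (e : rel T) (x0 : T) k (s : seq T) (j : 'I_k) :
  size s = k -> cycle e s -> e (nth x0 s j) (nth x0 s (ordS j)).
Proof.
move=> sz; subst k; case: s j => [[]//|x p] j /=; have jk := ltn_ord j.
move/(pathP x0) => /(_ j); rewrite size_rcons => /(_ jk).
rewrite -rcons_cons nth_rcons jk nth_rcons.
have [jp|jp|jp] := ltngtP j (size p); first by rewrite modn_small.
  by move: jk; rewrite ltnS leqNgt jp.
by rewrite jp modnn.
Qed.

(** * Eliminating the colours one at a time *)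

Section Arrowing.

Variables (t n : nat) (ns : 'I_t -> nat).
Hypothesis n_gt0 : 0 < n.
Hypothesis ns_even : forall i, ~~ odd (ns i).
Hypothesis ns_le : forall i, ns i <= n.
Hypothesis ns_ge : forall i, 2 * up_log 2 (81 ^ t * n) + 2 <= ns i.

Lemma colour_step (T : finType) (e : rel T) (side : pred T) r i (X Y : {set T}) :
  symmetric e -> (forall x y, e x y -> side x = ~~ side y) -> r < t ->
  {subset X <= [pred x | side x]} -> {subset Y <= [pred x | ~~ side x]} ->
  #|X| = 81 ^ r.+1 * n -> #|Y| = 81 ^ r.+1 * n ->
  (exists s, [/\ uniq s, size s = ns i & cycle e s]) \/
  exists X' Y' : {set T}, [/\ X' \subset X, Y' \subset Y, #|X'| = 81 ^ r * n,
    #|Y'| = 81 ^ r * n & forall x y, x \in X' -> y \in Y' -> ~~ e x y].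
Proof.
move=> e_sym e_side rt sX sY cX cY; set m := 81 ^ r * n.
have pX : part side (X :|: Y) true = X.
  apply/setP => x; rewrite !inE; apply/andP/idP => [[/orP[//|/sY]]|xX].
    by rewrite inE; case: (side x).
  by have := sX _ xX; rewrite xX inE => ->.
have pY : part side (X :|: Y) false = Y.
  apply/setP => x; rewrite !inE; apply/andP/idP => [[/orP[/sX|//]]|xY].
    by rewrite inE => ->.
  by have := sY _ xY; rewrite xY orbT inE => /negbTE->.
have [/existsP[[Z1 Z2] /= /and5P[s1 s2 c1 c2 no]]|hf] :=
  boolP [exists Z : {set T} * {set T}, [&& Z.1 \subset X, Z.2 \subset Y,
    m <= #|Z.1|, m <= #|Z.2| & [forall x in Z.1, forall y in Z.2, ~~ e x y]]].
  right; have [X' sX' cX'] := subset_of_card c1; have [Y' sY' cY'] := subset_of_card c2.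
  exists X', Y'; split=> //; [exact: subset_trans s1|exact: subset_trans s2|].
  move=> x y /(subsetP sX') xZ /(subsetP sY') yZ.
  by move/forall_inP/(_ _ xZ)/forall_inP: no; apply.
left; have m0 : 0 < m by rewrite muln_gt0 expn_gt0.
have nm : n <= m by rewrite leq_pmull // expn_gt0.
have mS : 81 * m = 81 ^ r.+1 * n by rewrite expnS mulnA.
apply: (@hole_free_cycle _ e side e_sym e_side m (X :|: Y)) => //.
- move=> Z1 Z2; rewrite pX pY => s1 s2 c1 c2.
  move: hf; rewrite negb_exists => /forallP/(_ (Z1, Z2)) /=.
  rewrite s1 s2 c1 c2 /= negb_forall => /existsP[x]; rewrite negb_imply => /andP[xZ].
  rewrite negb_forall => /existsP[y]; rewrite negb_imply negbK => /andP[yZ exy].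
  by exists x, y.
- by case; rewrite ?pX ?pY ?cX ?cY mS.
(* Doubling [m] raises [up_log] by one, and [2 * m <= 81 * m <= 81 ^ t * n]; this turns the [+ 2] of
   [ns_ge] into the [+ 4] required for cycles at scale [m]. *)
- have : (up_log 2 m).+1 <= up_log 2 (81 ^ t * n).
    rewrite -up_logMp //; apply: leq_up_log; apply: (@leq_trans (81 * m)).
      by rewrite leq_mul2r orbT.
    by rewrite mS leq_mul2r leq_exp2l // rt orbT.
  by have := ns_ge i; move: (up_log 2 m) (up_log 2 _) (ns i); clear; lia.
exact: leq_trans (ns_le i) nm.
Qed.

Lemma host_arrows (E : {set 'I_(81 ^ t * n) * 'I_(81 ^ t * n)}) :
  (forall X Y : {set 'I_(81 ^ t * n)}, #|X| = n -> #|Y| = n ->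
     exists a b, [/\ a \in X, b \in Y & (a, b) \in E]) ->
  arrows_cycles (host_adj E) ns.
Proof.
set M := 81 ^ t * n in E * => hitE c c_sym.
have [//|none] := Classical_Prop.classic (exists i, Defs.mono_cycle (host_adj E) c i (ns i)).
exfalso.
(* Stage [s] has excluded the colours below [s] between [X] and [Y]. At [s = t] no colour is left,
   yet [E] still meets the remaining rectangle. *)
have stages s : s <= t -> exists X Y : {set 'I_(M + M)},
    [/\ {subset X <= [pred x | host_side x]}, {subset Y <= [pred x | ~~ host_side x]},
     #|X| = 81 ^ (t - s) * n, #|Y| = 81 ^ (t - s) * n &
     forall x y, x \in X -> y \in Y -> host_adj E x y -> s <= c x y].
  elim: s => [_|s IH st].
    exists [set x | host_side x], [set x | ~~ host_side x]; rewrite subn0 -/M; split=> //.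
    - by move=> x; rewrite !inE.
    - by move=> x; rewrite !inE.
    - rewrite (_ : [set x | _] = [set lshift M a | a in 'I_M]).
        by rewrite card_imset ?card_ord //; exact: lshift_inj.
      apply/setP => x; rewrite inE /host_side; case: split_ordP => a ->.
        by rewrite imset_f.
      by apply/esym/imsetP => -[b _ /eqP]; rewrite eq_rlshift.
    rewrite (_ : [set x | _] = [set rshift M a | a in 'I_M]).
      by rewrite card_imset ?card_ord //; exact: rshift_inj.
    apply/setP => x; rewrite inE /host_side; case: split_ordP => a ->.
      by apply/esym/imsetP => -[b _ /eqP]; rewrite eq_lrshift.
    by rewrite imset_f.
  have [X [Y [sX sY cX cY hXY]]] := IH (ltnW st).
  have rt : t - s.+1 < t by move: st; clear; lia.
  have rS : t - s = (t - s.+1).+1 by move: st; clear; lia.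
  pose i := Ordinal st; pose e x y := host_adj E x y && (c x y == i).
  have e_sym : symmetric e.
    by move=> x y; rewrite /e (host_simple E).2 c_sym.
  have e_side x y : e x y -> host_side x = ~~ host_side y.
    by case/andP => /host_adj_side.
  rewrite rS in cX cY.
  have [[q [uq szq cq]]|[X' [Y' [sX' sY' cX' cY' no]]]] :=
    colour_step i e_sym e_side rt sX sY cX cY.
    case: none; exists i; split.
      (* A positive logarithm makes the length at least 4, so that it is a genuine cycle length. *)
      have up0 : 0 < up_log 2 (81 ^ t * n).
        rewrite up_log_gt0 /=; apply: leq_trans (leq_pmulr _ n_gt0).
        by rewrite -(expn0 81) ltn_exp2l // (leq_ltn_trans (leq0n s) st).
      by have := ns_ge i; move: up0; move: (up_log _ _) (ns i); clear; lia.
    case: q => [|x0 q] in uq szq cq *.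
      by exfalso; have := ns_ge i; rewrite -szq addn2.
    exists (fun j => nth x0 (x0 :: q) j); split=> [j1 j2 /eqP|j].
      by rewrite nth_uniq ?szq // => /eqP/val_inj.
    by have /andP[? /eqP ?] := cycle_ordS x0 j szq cq.
  exists X', Y'; split=> //.
  - by move=> x /(subsetP sX')/sX.
  - by move=> x /(subsetP sY')/sY.
  move=> x y xX yY axy; rewrite ltn_neqAle.
  rewrite (hXY x y (subsetP sX' _ xX) (subsetP sY' _ yY) axy) andbT.
  by have := no _ _ xX yY; rewrite /e axy /= eq_sym.
have [X [Y [sX sY cX cY hXY]]] := stages t (leqnn t).
rewrite subnn mul1n in cX cY.
pose X' := [set a | lshift M a \in X]; pose Y' := [set a | rshift M a \in Y].
have cX' : #|X'| = n.
  rewrite -cX -(card_imset _ (@lshift_inj M M)); apply: eq_card => x.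
  apply/imsetP/idP => [[a]|xX]; first by rewrite inE => ? ->.
  move: (sX _ xX) (xX); rewrite inE /host_side; case: split_ordP => a -> // _ aX.
  by exists a; rewrite ?inE.
have cY' : #|Y'| = n.
  rewrite -cY -(card_imset _ (@rshift_inj M M)); apply: eq_card => x.
  apply/imsetP/idP => [[a]|xY]; first by rewrite inE => ? ->.
  move: (sY _ xY) (xY); rewrite inE /host_side; case: split_ordP => a -> // _ aY.
  by exists a; rewrite ?inE.
have [a [b [aX bY abE]]] := hitE _ _ cX' cY'.
rewrite !inE in aX bY.
have := hXY _ _ aX bY; rewrite /host_adj (unsplitK (inl a)) (unsplitK (inr b)) abE => /(_ isT).
by rewrite leqNgt ltn_ord.
Qed.

End Arrowing.

(** * The size-Ramsey number as a minimum *)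

Lemma least_nat (P : nat -> Prop) m : P m -> exists2 k, P k & forall j, P j -> k <= j.
Proof.
elim/ltn_ind: m => m IH Pm.
have [[j [jm Pj]]|no] := Classical_Prop.classic (exists j, j < m /\ P j); first exact: IH Pj.
by exists m => // j Pj; rewrite leqNgt; apply/negP => jm; case: no; exists j.
Qed.

Theorem theorem3p6 :
  forall t : nat, (0 < t)%N ->
  exists n0 : nat,
  forall ns : 'I_t -> nat,
    (forall i, ~~ odd (ns i) /\ (0 < ns i)%N) ->
    (n0 <= \max_(i < t) ns i)%N ->
    (forall i, (2 * up_log 2 (81 ^ t * \max_(j < t) ns j) + 2 <= ns i)%N) ->
    exists m : nat,
      is_size_ramsey_cycles ns m /\
      Rle (INR m) (cycle_bound t (\max_(i < t) ns i)).
Proof.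
(* The threshold 1 provides [0 < n] for the counting estimates. *)
move=> t t0; exists 1 => ns nsP n0 ns_ge; set n := \max_(i < t) ns i in n0 ns_ge *.
have [q [qle qgt]] := nat_floor (cycle_bound_ge0 t n).
have [E [cE hitE]] := rectangle_hitting_set (rectangle_count n0 qgt).
have arrow : arrows_cycles (host_adj E) ns.
  apply: host_arrows => // i; first by case: (nsP i).
  exact: leq_bigmax.
have [k [N [adj [sg [nk ar]]]] kmin] := @least_nat (fun k => exists N (adj : rel 'I_N),
  simple_graph adj /\ num_edges adj = k /\ arrows_cycles adj ns) _
  (ex_intro _ _ (ex_intro _ _ (conj (host_simple E) (conj erefl arrow)))).
exists k; split.
  split; first by exists N, adj.
  by move=> N' adj' sg' ar'; apply: kmin; exists N', adj'.
apply: Rle_trans qle; apply: le_INR; apply/leP.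
apply: leq_trans cE; apply: leq_trans (num_edges_host E).
by apply: kmin; exists _, (host_adj E); split; first exact: host_simple.
Qed.
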